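(* Let $P$ be a finite Eulerian Sheffer poset of odd rank $n=2m+1\geq 5$ with $B(3)=6$ and $D(3)=4$. Then there is a positive integer $\alpha$ such that $P\cong\boxplus^\alpha(\Sigma^*(B_{2m}))$.
   Context: A finite graded poset with minimum $\hat 0$ and maximum $\hat 1$ is Eulerian if every interval $[x,y]$ with $x<y$ has as many elements of even rank as of odd rank. A finite Sheffer poset is a finite poset with $\hat 0$ and $\hat 1$ in which every interval is graded, any two intervals $[\hat 0,y]$ of the same length $n$ have the same number $D(n)$ of maximal chains (Sheffer factorial function), and any two intervals $[x,y]$ of the same length $n$ with $x\neq\hat 0$ have the same number $B(n)$ of maximal chains (binomial factorial function). $B_n$ is the boolean lattice of subsets of $\{1,\dots,n\}$ ordered by inclusion. For a poset $Q$ with unique minimum and maximum, $\boxplus^k(Q)$ is obtained from $k$ disjoint copies of $Q$ by identifying all minimum elements into one and all maximum elements into one. For a poset $R$ with minimum $\hat 0$, the dual suspension $\Sigma^*(R)$ is $R$ together with two new incomparable elements $a_1,a_2$, ordered so that $\hat 0<a_i<y$ for every $y>\hat 0$ in $R$ and $i=1,2$. *)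

(* Defs.v *)
From HB Require Import structures.
From mathcomp Require Import all_boot all_order.
Set Implicit Arguments.
Unset Strict Implicit.
Unset Printing Implicit Defensive.
Import Order.TTheory.
Local Open Scope order_scope.

Section MaximalChains.
Variables (d : Order.disp_t) (P : finPOrderType d).
Implicit Types (x y : P) (C : {set P}).

Definition intv x y : {set P} := [set z | x <= z <= y].

Definition is_chain C : bool := [forall x in C, forall y in C, x >=< y].

Definition maxchains x y : {set {set P}} :=
  [set C | maxset [pred A : {set P} | (A \subset intv x y) && is_chain A] C].

Definition graded_intv x y : Prop :=
  forall C1 C2, C1 \in maxchains x y -> C2 \in maxchains x y -> #|C1| = #|C2|.

(* A maximal chain with k+1 elements has length k; if [x, y] is graded, all   *)
(* its maximal chains have this length.                                       *)
Definition intv_length x y : nat := (\max_(C in maxchains x y) #|C|)%N.-1.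

End MaximalChains.

Section EulerianSheffer.
Variables (d : Order.disp_t) (P : finTBPOrderType d).
Implicit Types x y : P.

Definition rank x : nat := intv_length \bot x.

Definition poset_rank : nat := rank \top.

Definition eulerian : Prop :=
  graded_intv (\bot : P) \top /\
  forall x y, x < y ->
    #|[set z in intv x y | ~~ odd (rank z)]|
      = #|[set z in intv x y | odd (rank z)]|.

(* D is a Sheffer factorial function and B a binomial factorial function of   *)
(* P; their values at lengths of no interval of the relevant kind are free.   *)
Definition sheffer (D B : nat -> nat) : Prop :=
  [/\ forall x y, x <= y -> graded_intv x y,
      forall y, #|maxchains \bot y| = D (intv_length \bot y)
    & forall x y, x != \bot -> x <= y -> #|maxchains x y| = B (intv_length x y)].

End EulerianSheffer.

Arguments poset_rank {d} P.
Arguments eulerian {d} P.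
Arguments sheffer {d} P D B.

Section DualSuspension.
Variables (d : Order.disp_t) (R : finBPOrderType d).

(* inr false and inr true are the two new elements.                           *)
Definition dual_susp : Type := (R + bool)%type.

HB.instance Definition _ := Finite.on dual_susp.

Definition dual_susp_le (u v : dual_susp) : bool :=
  match u, v with
  | inl x, inl y => x <= y
  | inl x, inr _ => x == \bot
  | inr _, inl y => \bot < y
  | inr i, inr j => i == j
  end.

Fact dual_susp_le_refl : reflexive dual_susp_le.
Proof. by case=> [x|i] /=. Qed.

Fact dual_susp_le_anti : antisymmetric dual_susp_le.
Proof.
case=> [x|i] [y|j] //=; first by move=> /le_anti ->.
- by case/andP=> /eqP ->; rewrite ltxx.
- by case/andP=> lt0y /eqP y0; rewrite y0 ltxx in lt0y.
- by case/andP=> /eqP ->.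
Qed.

Fact dual_susp_le_trans : transitive dual_susp_le.
Proof.
case=> [y|j] [x|i] [z|k] //=.
all: try by move=> /eqP ->.
- exact: le_trans.
- by move=> le_xy /eqP y0; rewrite y0 lex0 in le_xy.
- exact: lt_le_trans.
- by move=> lt0y /eqP y0; rewrite y0 ltxx in lt0y.
Qed.

HB.instance Definition _ := Order.Le_isPOrder.Build d dual_susp
  dual_susp_le_refl dual_susp_le_anti dual_susp_le_trans.

End DualSuspension.

Section BoxPlus.
Variables (d : Order.disp_t) (k : nat) (Q : finPOrderType d).

Definition is_min (x : Q) : bool := [forall y : Q, x <= y].
Definition is_max (x : Q) : bool := [forall y : Q, y <= x].

(* Elements of k disjoint copies of Q, the minima (resp. maxima) of all the   *)
(* copies being represented by the one of copy 0.                             *)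
Definition boxplus_pred (u : 'I_k * Q) : bool :=
  (is_min u.2 || is_max u.2) ==> (u.1 == 0 :> nat).

Record boxplus : Type := BoxPlus {
  boxplus_val :> 'I_k * Q;
  _ : boxplus_pred boxplus_val
}.

HB.instance Definition _ := [isSub for boxplus_val].
HB.instance Definition _ := [Finite of boxplus by <:].

Definition boxplus_le (u v : boxplus) : bool :=
  ((val u).2 <= (val v).2) &&
  [|| (val u).1 == (val v).1, is_min (val u).2 | is_max (val v).2].

Fact boxplus_le_refl : reflexive boxplus_le.
Proof. by move=> u; rewrite /boxplus_le lexx eqxx. Qed.

Fact boxplus_le_anti : antisymmetric boxplus_le.
Proof.
move=> [[i p] pP] [[j q] qP]; rewrite /boxplus_le /=.
case/andP=> /andP[le_pq Hpq] /andP[le_qp Hqp].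
have epq : p = q by apply/le_anti; rewrite le_pq.
move: epq pP qP Hpq Hqp => -> {p le_pq le_qp} pP qP Hpq _.
apply: val_inj => /=; congr (_, _).
case/orP: Hpq => [/eqP //|mq].
by apply: val_inj; rewrite /= (eqP (implyP pP mq)) (eqP (implyP qP mq)).
Qed.

Fact boxplus_le_trans : transitive boxplus_le.
Proof.
move=> [[j q] qP] [[i p] pP] [[l r] rP]; rewrite /boxplus_le /=.
case/andP=> le_pq Hpq /andP[le_qr Hqr]; rewrite (le_trans le_pq le_qr) /=.
have minq : is_min q -> is_min p.
  by move/forallP=> mq; apply/forallP=> y; exact: le_trans le_pq (mq y).
have maxq : is_max q -> is_max r.
  by move/forallP=> mq; apply/forallP=> y; exact: le_trans (mq y) le_qr.
case/or3P: Hpq => [/eqP ->|->|/maxq ->]; rewrite ?orbT //.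
by case/or3P: Hqr => [->|/minq ->|->]; rewrite ?orbT.
Qed.

HB.instance Definition _ := Order.Le_isPOrder.Build d boxplus
  boxplus_le_refl boxplus_le_anti boxplus_le_trans.

End BoxPlus.

Import Order.DefaultSetSubsetOrder.

Definition boolean_lattice (n : nat) : finTBPOrderType _ := {set 'I_n}.

Definition order_iso (d d' : Order.disp_t) (P : porderType d)
    (Q : porderType d') : Prop :=
  exists2 f : P -> Q, bijective f & {mono f : x y / x <= y}.

(* Main.v *)
Require Import Defs.
From mathcomp Require Import all_boot all_order.
From mathcomp Require Import all_algebra zify ring.

(* Every maximal chain of [x, y] passes through exactly one element covering x,
   so the Sheffer condition says that the number of atoms of an interval depends
   only on its length: A(k) atoms for an interval of length k with bottom
   different from 0, and A'(k) for an interval [0, y] with y of rank k.  The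
   hypotheses B(3) = 6 and D(3) = 4 become A(3) = 3 and A'(3) = 2.

   For odd k, suppose A(i) = i for i < k and put c = A(k), e = A(k+1).  Double
   counting the level sizes of an interval of length k+1 turns the Euler relation
   into e (k+1-c) = k+1, and since c >= k-1 and e >= c this forces c = k and
   e = k+1.  Hence A(i) = i up to 2m, and an induction from the top shows that
   every [x, 1] with x <> 0 is Boolean, an element z being determined by the set
   of the elements covering x that lie below z.

   Two elements of rank 2 above an atom a have a common upper bound of rank 3,
   which lies above two atoms only; so all the elements of rank 2 above a share
   their second atom, the mate of a, and a and its mate have the same elements
   strictly above them.  The Euler relation for [0, y] with y of even rank k+1
   now gives c (4 + e (k-2)) = 2 e k with c = A'(k), e = A'(k+1).  As c <> 3
   because atoms come in pairs, c = e = 2.  So every element of rank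
   2, ..., 2m lies above exactly one pair of mates, each pair contributes one
   copy of the dual suspension of B_{2m}, and these copies share only 0 and 1. *)

Set Implicit Arguments.
Unset Strict Implicit.
Unset Printing Implicit Defensive.
Import Order.TTheory.

(** * Maximal chains *)

Section MaximalChains.
Local Open Scope order_scope.
Variables (d : Order.disp_t) (P : finPOrderType d).
Implicit Types (x y z s t : P) (C : {set P}).

Definition covered x s := (x < s) && [forall z, (x < z) ==> ~~ (z < s)].

Lemma covered_between x s z : covered x s -> x < z -> z <= s -> z = s.
Proof.
case/andP=> _ /forallP/(_ z)/implyP cov ltxz.
by rewrite le_eqVlt (negPf (cov ltxz)) orbF => /eqP.
Qed.

Lemma is_chainP C :
  reflect {in C &, forall x y, x >=< y} (is_chain C).
Proof.
apply: (iffP forall_inP) => [H x y xC yC|H x xC].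
  exact: (forall_inP (H x xC)).
by apply/forall_inP => y yC; apply: H.
Qed.

(** Maximality need only be tested on single elements: adding to a chain an element comparable with
    all of it gives a chain again. *)
Lemma maxchainsP x y C :
  reflect [/\ {subset C <= intv x y}, {in C &, forall s t, s >=< t}
            & forall z, x <= z <= y -> {in C, forall t, z >=< t} -> z \in C]
          (C \in maxchains x y).
Proof.
rewrite inE; apply: (iffP maxsetP).
  case=> /andP[/subsetP sub /is_chainP chC] maxC; split=> // z zxy cz.
  suff <- : z |: C = C by rewrite setU11.
  apply: maxC; last exact: subsetUr.
  apply/andP; split.
    by apply/subsetP => t /setU1P[->|/sub//]; rewrite inE.
  apply/is_chainP => s t /setU1P[->|sC] /setU1P[->|tC].
  - exact: comparablexx.
  - exact: cz.
  - by rewrite comparable_sym; exact: cz.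
  - exact: chC.
case=> sub chC maxC; split.
  by apply/andP; split; [apply/subsetP|apply/is_chainP].
move=> A /andP[/subsetP subA /is_chainP chA] /subsetP CA.
apply/setP => z; apply/idP/idP => [zA|/CA//].
apply: maxC => [|t tC]; first by have := subA z zA; rewrite inE.
by apply: chA => //; apply: CA.
Qed.

Lemma maxchains_bot x y C : x <= y -> C \in maxchains x y -> x \in C.
Proof.
move=> lexy /maxchainsP[sub _ maxC]; apply: maxC => [|t /sub]; first by rewrite lexx.
by rewrite inE => /andP[lext _]; rewrite /Order.comparable lext.
Qed.

Lemma maxchains_top x y C : x <= y -> C \in maxchains x y -> y \in C.
Proof.
move=> lexy /maxchainsP[sub _ maxC]; apply: maxC => [|t /sub]; first by rewrite lexx andbT.
by rewrite inE => /andP[_ lety]; rewrite /Order.comparable lety orbT.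
Qed.

Lemma maxchains_gt0 x y : (0 < #|maxchains x y|)%N.
Proof.
have P0 : [pred A : {set P} | (A \subset intv x y) && is_chain A] set0.
  by rewrite /= sub0set; apply/is_chainP => s t; rewrite inE.
by have [A AP _] := maxset_exists P0; apply/card_gt0P; exists A; rewrite inE.
Qed.

Lemma maxchains_refl x : maxchains x x = [set [set x]].
Proof.
apply/setP => C; rewrite in_set1; apply/idP/eqP => [mC|->].
  have xC := maxchains_bot (lexx x) mC.
  apply/setP => z; rewrite in_set1; apply/idP/eqP => [zC|-> //].
  by case/maxchainsP: mC => /(_ z zC) + _ _; rewrite inE; case/andP => le1 le2; apply/le_anti/andP.
apply/maxchainsP; split.
- by move=> z /set1P->; rewrite inE !lexx.
- by move=> s t /set1P-> /set1P->; rewrite comparablexx.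
- by move=> z /le_anti <- _; rewrite set11.
Qed.

Lemma maxchains_cons x s y C : covered x s -> s <= y ->
  C \in maxchains s y -> x |: C \in maxchains x y.
Proof.
move=> cov lesy mC; have sC := maxchains_bot lesy mC.
have ltxs : x < s by case/andP: cov.
case/maxchainsP: mC => sub chC maxC; apply/maxchainsP.
have gex t : t \in C -> x <= t.
  by move/sub; rewrite inE => /andP[le1 _]; apply: le_trans (ltW ltxs) le1.
split.
- move=> z /setU1P[->|zC]; first by rewrite inE lexx (le_trans (ltW ltxs)).
  by have := sub z zC; rewrite !inE gex // => /andP[_ ->].
- move=> u v /setU1P[->|uC] /setU1P[->|vC].
  + by rewrite comparablexx.
  + by rewrite /Order.comparable gex.
  + by rewrite /Order.comparable (gex u) ?orbT.
  + exact: chC.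
- move=> z /andP[lexz lezy] cz.
  move: lexz; rewrite le_eqVlt => /orP[/eqP<-|ltxz]; first exact: setU11.
  apply: setU1r; apply: maxC => [|t tC]; last by apply: cz; apply: setU1r.
  rewrite lezy andbT.
  have /orP[lezs|//] := cz s (setU1r _ sC).
  by rewrite (covered_between cov ltxz lezs).
Qed.

(** Together with [maxchains_cons], this matches the maximal chains of [[s, y]] with those of
    [[x, y]] through [s]. *)
Lemma maxchains_uncons x s y C : covered x s -> s <= y ->
  C \in maxchains x y -> s \in C -> C :\ x \in maxchains s y.
Proof.
move=> cov lesy mC sC; have ltxs : x < s by case/andP: cov.
case/maxchainsP: mC => sub chC maxC; apply/maxchainsP.
split.
- move=> z /setD1P[neq zC]; have := sub z zC; rewrite !inE => /andP[lexz ->].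
  have ltxz : x < z by rewrite lt_neqAle eq_sym neq.
  rewrite andbT; have /orP[lezs|//] := chC z s zC sC.
  by rewrite (covered_between cov ltxz lezs).
- by move=> u v /setD1P[_ uC] /setD1P[_ vC]; apply: chC.
- move=> z /andP[lesz lezy] cz; apply/setD1P; split.
    by rewrite gt_eqF // (lt_le_trans ltxs).
  apply: maxC => [|t tC]; first by rewrite lezy (le_trans (ltW ltxs)).
  have [->|neq] := eqVneq t x; last by apply: cz; apply/setD1P.
  by rewrite /Order.comparable (le_trans (ltW ltxs) lesz) orbT.
Qed.

Lemma maxchains_covered x y C : x < y -> C \in maxchains x y ->
  exists s, [/\ s \in C, covered x s & s <= y].
Proof.
move=> ltxy mC; have yC := maxchains_top (ltW ltxy) mC.
have yCx : y \in C :\ x by apply/setD1P; rewrite gt_eqF.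
(* Within a chain, the element with the smallest principal ideal is the least one; here it is the
   successor of [x] in [C]. *)
have [s /setD1P[nsx sC] smin] :=
  @arg_minnP _ y [in C :\ x] (fun z => #|[set t | t <= z]|) yCx.
case/maxchainsP: mC => sub chC maxC.
have := sub s sC; rewrite inE => /andP[lexs lesy].
have ltxs : x < s by rewrite lt_neqAle eq_sym nsx.
exists s; split=> //; rewrite /covered ltxs /=; apply/forallP => z; apply/implyP => ltxz.
apply/negP => ltzs.
have lemin t : t \in C -> t != x -> s <= t.
  move=> tC ntx; have /orP[//|lets] := chC s t sC tC.
  have [->//|nts] := eqVneq t s.
  have /smin : t \in C :\ x by apply/setD1P.
  rewrite leqNgt => /negP[]; apply: proper_card; apply/properP; split.
    by apply/subsetP => u; rewrite !inE => /le_trans; apply.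
  exists s; rewrite !inE ?lexx //; apply/negP => lest.
  by case/negP: nts; apply/eqP/le_anti/andP.
have zC : z \in C.
  apply: maxC => [|t tC]; first by rewrite (ltW ltxz) (le_trans (ltW ltzs)).
  have [->|neq] := eqVneq t x; first by rewrite /Order.comparable (ltW ltxz) orbT.
  by rewrite /Order.comparable (le_trans (ltW ltzs)) ?lemin.
by have := lemin z zC; rewrite gt_eqF // lt_geF // => /(_ isT).
Qed.

Lemma covered_exists x y : x < y -> exists2 s, covered x s & s <= y.
Proof.
move=> ltxy; have /card_gt0P[C mC] := maxchains_gt0 x y.
by have [s [_ cov le]] := maxchains_covered ltxy mC; exists s.
Qed.

Lemma card_maxchains x y : x < y ->
  #|maxchains x y| = (\sum_(s | covered x s && (s <= y)%O) #|maxchains s y|)%N.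
Proof.
move=> ltxy.
transitivity (\sum_(C in maxchains x y)
                \sum_(s | covered x s && (s <= y)%O) (s \in C))%N.
  rewrite -sum1_card; apply: eq_bigr => C mC.
  have [s [sC cov lesy]] := maxchains_covered ltxy mC.
  rewrite (bigD1 s) ?cov //= sC big1 // => t /andP[/andP[covt lety] nts].
  apply/eqP; rewrite eqb0; apply/negP => tC; case/negP: nts; apply/eqP.
  case/maxchainsP: mC => _ chC _.
  have /orP[lets|lest] := chC t s tC sC.
    by apply: (covered_between cov) => //; case/andP: covt.
  by rewrite (covered_between covt _ lest) //; case/andP: cov.
rewrite exchange_big /=; apply: eq_bigr => s /andP[cov lesy].
have ltxs : x < s by case/andP: cov.
have nx C : C \in maxchains s y -> x \notin C.
  case/maxchainsP => sub _ _; apply/negP => /sub; rewrite inE.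
  by rewrite lt_geF.
rewrite -(@card_in_imset _ _ (fun C => x |: C) (mem (maxchains s y))); last first.
  by move=> C1 C2 /nx n1 /nx n2 E; rewrite -(setU1K n1) E setU1K.
rewrite -sum1_card -big_mkcondr /=; apply: eq_bigl => C.
apply/andP/imsetP => [[mC sC]|[C' mC' ->]].
  exists (C :\ x); first exact: maxchains_uncons cov lesy mC sC.
  by rewrite setD1K // (maxchains_bot (ltW ltxy) mC).
by split; [exact: maxchains_cons cov lesy mC'|apply/setU1r/(maxchains_bot lesy)].
Qed.

Lemma intv_length_card x y C : x <= y -> graded_intv x y ->
  C \in maxchains x y -> #|C| = (intv_length x y).+1.
Proof.
move=> lexy gr mC; rewrite /intv_length (@eq_bigr _ _ _ _ _ _ _ (fun=> #|C|)); last first.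
  by move=> C' mC'; apply: gr.
have -> : (\max_(i in maxchains x y) #|C| = #|C|)%N.
  by apply/eqP; rewrite eqn_leq (bigop.bigmax_sup C) // andbT; apply/bigop.bigmax_leqP.
by rewrite prednK //; apply/card_gt0P; exists x; apply: maxchains_bot mC.
Qed.

Lemma intv_length_refl x : intv_length x x = 0%N.
Proof. by rewrite /intv_length maxchains_refl big_set1 cards1. Qed.

Lemma intv_length_covered x s y : graded_intv x y -> graded_intv s y ->
  covered x s -> s <= y -> intv_length x y = (intv_length s y).+1.
Proof.
move=> grx grs cov lesy; have ltxs : x < s by case/andP: cov.
have /card_gt0P[C mC] := maxchains_gt0 s y.
have := intv_length_card (le_trans (ltW ltxs) lesy) grx (maxchains_cons cov lesy mC).
rewrite cardsU1 (intv_length_card lesy grs mC).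
case/maxchainsP: mC => sub _ _; case: (boolP (x \in C)) => [/sub|_ []//].
by rewrite inE lt_geF.
Qed.

End MaximalChains.

(* [lia] diverges when hypotheses about the order of P are in scope. *)
Local Ltac rk_lia :=
  repeat match goal with
  | H : @eq nat _ _ |- _ => revert H
  | H : is_true (leq _ _) |- _ => revert H
  end; clear; lia.

(** * Alternating sums *)

Section AlternatingSums.
Import GRing.Theory.
Local Open Scope ring_scope.

(** The sum is the binomial expansion of $(1-1)^n$. *)
Lemma alternating_sum_binomial n : (0 < n)%N ->
  \sum_(j < n.+1) (-1) ^+ j * 'C(n, j)%:R = 0 :> int.
Proof.
move=> n_gt0; have := exprBn (1 : int) 1 n.
rewrite subrr expr0n gtn_eqF //= => /esym E; rewrite -[RHS]E.
by apply: eq_bigr => j _; rewrite !expr1n !mulr1 mulr_natr.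
Qed.

(** As [k] is odd, the four surviving terms carry the signs +, -, -, +. Both Euler computations
    apply this to an [h] that compares level sizes with multiples of binomial coefficients. *)
Lemma alternating_sum_ends (h : nat -> int) k : odd k -> (1 < k)%N ->
  \sum_(j < k.+2) (-1) ^+ j * h j = 0 ->
  (forall j, (1 < j < k)%N -> h j = 0) -> h 0 + h k.+1 = h 1 + h k.
Proof.
case: k => [//|[//|k]] odk _.
rewrite 2!big_ord_recr 2!big_ord_recl /= /bump /= => + h0.
rewrite big1 => [|i _]; last first.
  by rewrite h0 ?mulr0 //; have := ltn_ord i; lia.
rewrite !exprS -[(-1) ^+ k]signr_odd; move: odk => /= /negbNE ->.
move: (h 0) (h 1) (h k.+2) (h k.+3) => a b c e; rewrite /= => E.
by apply/eqP; rewrite -subr_eq0 -[X in _ == X]E; apply/eqP; ring.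
Qed.

End AlternatingSums.

(** * Order and extrema of the dual suspension of a Boolean lattice *)

Section DualSuspensionBoolean.
Variable n : nat.
Notation Q := (dual_susp (boolean_lattice n)).
Local Open Scope order_scope.

Lemma boolean_lt0 (S : boolean_lattice n) : (\bot < S) = (S != set0).
Proof. exact: lt0x. Qed.

Lemma is_min_inl (S : boolean_lattice n) : is_min (inl S : Q) = (S == set0).
Proof.
apply/forallP/eqP => [/(_ (inr true)) /eqP //|->] [S'|b]; last exact: eqxx.
exact: (sub0set S').
Qed.

Lemma is_min_inr b : is_min (inr b : Q) = false.
Proof. by apply/negP => /forallP/(_ (inr (~~ b))); case: b. Qed.

(** For [n = 0] the full set is empty and lies below both new elements, whence the condition
    [0 < n]. *)
Lemma is_max_inl (S : boolean_lattice n) : (0 < n)%N ->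
  is_max (inl S : Q) = (S == setT).
Proof.
move=> n_gt0; apply/forallP/eqP => [/(_ (inl setT)) H|->].
  by apply/eqP; rewrite -subTset.
case=> [S'|b]; first exact: (subsetT S').
change (\bot < (setT : boolean_lattice n)); rewrite boolean_lt0 -card_gt0 cardsT card_ord //.
Qed.

Lemma is_max_inr b : is_max (inr b : Q) = false.
Proof. by apply/negP => /forallP/(_ (inr (~~ b))); case: b. Qed.

Lemma dual_susp_inlE (S S' : boolean_lattice n) :
  ((inl S : Q) <= inl S') = (S \subset S').
Proof. by []. Qed.

Lemma dual_susp_inl_inr (S : boolean_lattice n) b :
  ((inl S : Q) <= inr b) = (S == set0).
Proof. by []. Qed.

Lemma dual_susp_inr_inl (S : boolean_lattice n) b :
  ((inr b : Q) <= inl S) = (S != set0).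
Proof. exact: boolean_lt0. Qed.

Lemma dual_susp_inrE b b' : ((inr b : Q) <= inr b') = (b == b').
Proof. by []. Qed.

End DualSuspensionBoolean.

(** * Eulerian posets whose atom numbers depend only on length *)

Section RankedPoset.
Import GRing.Theory.
Local Open Scope order_scope.
Variables (d : Order.disp_t) (P : finTBPOrderType d) (rk : P -> nat).
Implicit Types (x y z s t w : P).

(** The index is the height above [x], not the rank, so that level 1 consists of the atoms of
    [[x, y]]. *)
Definition lev x y j : {set P} := [set z in intv x y | rk z == (rk x + j)%N].

Hypothesis rk_lt : forall x y, x < y -> (rk x < rk y)%N.
Hypothesis rk_cov : forall x y, x < y ->
  exists s, [/\ x < s, s <= y & rk s = (rk x).+1].
Hypothesis euler : forall x y, x < y ->
  #|[set z in intv x y | ~~ odd (rk z)]| = #|[set z in intv x y | odd (rk z)]|.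

Lemma levP x y j z :
  reflect [/\ x <= z, z <= y & rk z = (rk x + j)%N] (z \in lev x y j).
Proof.
rewrite !inE; apply: (iffP andP) => [[/andP[le1 le2] /eqP]|[-> -> ->]] //.
Qed.

Lemma rk_le x y : x <= y -> (rk x <= rk y)%N.
Proof. by rewrite le_eqVlt => /orP[/eqP->//|/rk_lt/ltnW]. Qed.

Lemma rk_eq x y : x <= y -> rk x = rk y -> x = y.
Proof. by rewrite le_eqVlt => /orP[/eqP->//|/rk_lt + E]; rewrite E ltnn. Qed.

Lemma lev_exists x y j : x <= y -> (rk x + j <= rk y)%N ->
  exists z, z \in lev x y j.
Proof.
move=> lexy; elim: j => [_|j IH lej].
  by exists x; apply/levP; rewrite addn0.
have [|z /levP[le1 le2 E]] := IH; first by lia.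
have ltzy : z < y.
  by rewrite lt_neqAle le2 andbT; apply: contraTneq lej => <-; rewrite E; lia.
have [s [lt1 le3 E']] := rk_cov ltzy; exists s; apply/levP; split=> //; last lia.
exact: le_trans le1 (ltW lt1).
Qed.

Lemma lev0 x y : x <= y -> lev x y 0 = [set x].
Proof.
move=> lexy; apply/setP => z; rewrite in_set1; apply/levP/eqP => [[le1 _ E]|->].
  by rewrite (rk_eq le1) // E addn0.
by rewrite addn0.
Qed.

Lemma lev_top x y j : x <= y -> rk y = (rk x + j)%N -> lev x y j = [set y].
Proof.
move=> lexy E; apply/setP => z; rewrite in_set1; apply/levP/eqP => [[_ le1 E']|-> //].
by rewrite (rk_eq le1) // E E'.
Qed.

Lemma levS x y z j : y <= z -> lev x y j \subset lev x z j.
Proof.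
move=> leyz; apply/subsetP => t /levP[le1 le2 E]; apply/levP; split=> //.
exact: le_trans le2 leyz.
Qed.

(** Both sides count the pairs [s <= z] with [s] at height 1 and [z] at height [j.+1] above [x];
    such a [z] has height [j] above [s]. *)
Lemma lev_double_count x y j :
  (\sum_(s in lev x y 1) #|lev s y j| = \sum_(z in lev x y j.+1) #|lev x z 1|)%N.
Proof.
transitivity (\sum_(s in lev x y 1) \sum_(z in lev x y j.+1 | (s <= z)%O) 1)%N.
  apply: eq_bigr => s /levP[lexs lesy Es]; rewrite -sum1_card; apply: eq_bigl => z.
  apply/levP/andP => [[le1 le2 E]|[/levP[le1 le2 E] le3]]; last by split=> //; lia.
  by split=> //; apply/levP; split=> //; [exact: le_trans le1|lia].
rewrite (exchange_big_dep (fun z => z \in lev x y j.+1)) /=; last by move=> s z _ /andP[].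
apply: eq_bigr => z Hz; rewrite -sum1_card; apply: eq_bigl => s.
rewrite Hz; case/levP: Hz => le1 le2 E.
apply/andP/levP => [[/levP[? ? ?] ?] //|[le3 le4 E']].
by split=> //; apply/levP; split=> //; exact: le_trans le2.
Qed.

Lemma lev_double_count_const x y j a b :
  {in lev x y 1, forall s, #|lev s y j| = b} ->
  {in lev x y j.+1, forall z, #|lev x z 1| = a} ->
  (#|lev x y 1| * b = #|lev x y j.+1| * a)%N.
Proof.
move=> Hb Ha; have := lev_double_count x y j.
by rewrite (eq_bigr _ Hb) (eq_bigr _ Ha) !sum_nat_const.
Qed.

Lemma euler_lev x y n : x < y -> rk y = (rk x + n)%N ->
  (\sum_(j < n.+1) (-1) ^+ j * #|lev x y j|%:R = 0 :> int)%R.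
Proof.
move=> ltxy Ey.
have E0 : (\sum_(z in intv x y) (-1) ^+ rk z = 0 :> int)%R.
  rewrite (bigID (fun z => odd (rk z))) /=.
  rewrite (eq_bigr (fun=> -1)%R); last first.
    by move=> z /andP[_ odz]; rewrite -signr_odd odz.
  rewrite [X in (_ + X)%R](eq_bigr (fun=> 1)%R); last first.
    by move=> z /andP[_ /negPf odz]; rewrite -signr_odd odz.
  rewrite (eq_bigl (mem [set z in intv x y | odd (rk z)])); last first.
    by move=> z; rewrite /= [RHS]inE.
  rewrite [X in (_ + X)%R](eq_bigl (mem [set z in intv x y | ~~ odd (rk z)])); last first.
    by move=> z; rewrite /= [RHS]inE.
  by rewrite !sumr_const (euler ltxy) mulNrn addNr.
(* Multiplying by [(-1) ^+ rk x], which is regular, turns heights above [x] into ranks. *)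
apply/eqP; rewrite -(mulrI_eq0 _ (@lregX _ (-1)%R (rk x) (lregN (@lreg1 _)))).
rewrite -[X in _ == X]E0 (partition_big (fun z => inord (rk z - rk x) : 'I_n.+1) predT) //=.
rewrite mulr_sumr; apply/eqP/eq_bigr => j _; rewrite mulrA -exprD.
rewrite (eq_bigl (mem (lev x y j))); last first.
  move=> z; rewrite /= [RHS]inE; case: (boolP (z \in intv x y)) => //=.
  rewrite !inE => /andP[/rk_le le1 /rk_le le2]; rewrite -val_eqE /= inordK; lia.
rewrite (eq_bigr (fun=> (-1) ^+ (rk x + j))%R); last by move=> z /levP[_ _ ->].
by rewrite sumr_const mulr_natr.
Qed.

(** With one element at each end, the Euler relation reads 1 - N + 1 = 0. *)
Lemma card_lev_diamond x y : x <= y -> rk y = (rk x + 2)%N -> #|lev x y 1| = 2%N.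
Proof.
move=> lexy E; have ltxy : x < y.
  by rewrite lt_neqAle lexy andbT; apply: contra_eqN E => /eqP->; lia.
have := euler_lev ltxy E; rewrite !big_ord_recl big_ord0 /= /bump /=.
rewrite lev0 // (lev_top lexy E) !cards1 ?(expr0, exprS) !addn0 ?addr0; lia.
Qed.

(** * Atom numbers of the intervals with bottom different from 0 *)

Variables (A A' : nat -> nat) (m : nat).
Hypothesis rk0 : rk \bot = 0%N.
Hypothesis rkT : rk \top = (2 * m + 1)%N.
Hypothesis m_gt1 : (1 < m)%N.
Hypothesis card_lev1 : forall x y, x != \bot -> x <= y ->
  #|lev x y 1| = A (rk y - rk x).
Hypothesis card_atoms : forall y, #|lev \bot y 1| = A' (rk y).
Hypothesis A3 : A 3 = 3%N.
Hypothesis A'3 : A' 3 = 2%N.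

Lemma rk_gt0 x : (0 < rk x)%N = (x != \bot).
Proof.
have [->|nx] := eqVneq x \bot; first by rewrite rk0.
by have := @rk_lt \bot x; rewrite rk0 lt0x => ->.
Qed.

Lemma le_neq_bot x y : x != \bot -> x <= y -> y != \bot.
Proof. by rewrite -!rk_gt0 => ? /rk_le; lia. Qed.

Lemma rk_max x : (rk x <= 2 * m + 1)%N.
Proof. by rewrite -rkT rk_le ?lex1. Qed.

Lemma rk_top x : rk x = (2 * m + 1)%N -> x = \top.
Proof. by move=> E; apply: rk_eq (lex1 x) _; rewrite E rkT. Qed.

(** An [x] of rank 1 has length [2 * m] above it. So each of these values of [A] is attained by an
    interval, and identities between them can be proved by counting. *)
Lemma intv_exists n : (n <= 2 * m)%N ->
  exists x y, [/\ x != \bot, x <= y & rk y = (rk x + n)%N].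
Proof.
move=> len; have [||x /levP[_ _ Ex]] := @lev_exists \bot \top 1; rewrite ?le0x ?rk0 ?rkT //.
  by lia.
have [||y /levP[lexy _ Ey]] := @lev_exists x \top n; rewrite ?lex1 ?Ex ?rk0 ?rkT //.
  by lia.
by exists x, y; split; rewrite // -rk_gt0 Ex rk0.
Qed.

Lemma card_lev1E x y n : x != \bot -> x <= y -> rk y = (rk x + n)%N ->
  #|lev x y 1| = A n.
Proof. by move=> nx lexy E; rewrite card_lev1 // E addKn. Qed.

Lemma upper_atoms1 : A 1 = 1%N.
Proof.
have [|x [y [nx lexy E]]] := @intv_exists 1; first lia.
by rewrite -(card_lev1E nx lexy E) (lev_top lexy E) cards1.
Qed.

Lemma upper_atoms2 : A 2 = 2%N.
Proof.
have [|x [y [nx lexy E]]] := @intv_exists 2; first lia.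
by rewrite -(card_lev1E nx lexy E) card_lev_diamond.
Qed.

Lemma upper_atoms_mono i j : (i <= j)%N -> (j <= 2 * m)%N -> (A i <= A j)%N.
Proof.
move=> leij lej; have [|x [y [nx lexy E]]] := @intv_exists j; first lia.
have [||z /levP[lexz lezy Ez]] := @lev_exists x y i; rewrite ?E //; first lia.
by rewrite -(card_lev1E nx lexy E) -(card_lev1E nx lexz Ez) subset_leq_card ?levS.
Qed.

(** Induction on [j]: counting pairs between heights 1 and j+1 reproduces the recurrence n C(n-1, j)
    = (j+1) C(n, j+1). *)
Lemma card_lev_binom n : (forall i, (0 < i <= n)%N -> A i = i) ->
  forall x y j, x != \bot -> x <= y -> rk y = (rk x + n)%N ->
  #|lev x y j| = 'C(n, j).
Proof.
move=> An x y j; elim: j n An x y => [|j IH] n An x y nx lexy E.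
  by rewrite lev0 // cards1 bin0.
have [ltnj|lejn] := ltnP n j.+1.
  rewrite bin_small //; apply/eqP; rewrite cards_eq0 -subset0; apply/subsetP => z.
  by move=> /levP[_ /rk_le le1 Ez]; lia.
case: n => [//|n] in An E lejn *.
apply/eqP; rewrite -(eqn_pmul2r (ltn0Sn j)) [X in _ == X]mulnC -mul_bin_diag /=.
rewrite -(@lev_double_count_const x y j _ 'C(n, j)).
- by rewrite (card_lev1E nx lexy E) An ?leqnn.
- move=> s /levP[lexs lesy Es]; apply: IH => //; last lia.
    by move=> i Hi; apply: An; lia.
  exact: le_neq_bot lexs.
- move=> z /levP[lexz lezy Ez]; rewrite (card_lev1E nx lexz Ez) An //; lia.
Qed.

(** This is e (k+1-c) = k+1 without subtraction. In an interval of length k+1 the levels 2 to k-1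
    are proportional to binomial coefficients, so the Euler relation reduces to the four extreme
    levels. *)
Lemma upper_atoms_step k : odd k -> (2 < k)%N -> (k < 2 * m)%N ->
  (forall i, (0 < i < k)%N -> A i = i) ->
  (A k.+1 * k.+1 = A k.+1 * A k + k.+1)%N.
Proof.
move=> odk gtk ltk Ai.
have [|x [y [nx lexy E]]] := @intv_exists k.+1; first lia.
have ltxy : x < y by rewrite lt_neqAle lexy andbT; apply: contra_eqN E => /eqP->; lia.
have Ak' i : (0 < i <= k.-1)%N -> A i = i by move=> ?; apply: Ai; lia.
set e := A k.+1; set c := A k.
have c_gt0 : (0 < c)%N by have := @upper_atoms_mono 1 k; rewrite upper_atoms1; apply; lia.
(* Above an atom of [[s, y]] only length k-1 is left, where the level sizes are already binomial. *)
have Ns s i : (i.+1 < k)%N -> s \in lev x y 1 ->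
    (#|lev s y i.+1| * i.+1 = c * 'C(k.-1, i))%N.
  move=> lti /levP[lexs lesy Es].
  have ns := le_neq_bot nx lexs.
  have Ey : rk y = (rk s + k)%N by lia.
  rewrite -(@lev_double_count_const s y i _ 'C(k.-1, i)).
  - by rewrite (card_lev1E ns lesy Ey).
  - move=> t /levP[lest lety Et]; apply: card_lev_binom => //; last lia.
    exact: le_neq_bot lest.
  - by move=> z /levP[lesz lezy Ez]; rewrite (card_lev1E ns lesz Ez) Ai.
have Nx i : (i.+2 < k)%N ->
    (#|lev x y i.+2| * (k.+1 * k) = e * c * 'C(k.+1, i.+2))%N.
  move=> lti; apply/eqP; rewrite -(eqn_pmul2r (ltn0Sn i)) -(eqn_pmul2r (ltn0Sn i.+1)); apply/eqP.
  (* The quotient is the common size of level [i.+1] in all the [[s, y]]; [Ns] makes the division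
     exact. *)
  have dc : (e * (c * 'C(k.-1, i) %/ i.+1) = #|lev x y i.+2| * i.+2)%N.
    rewrite -(@lev_double_count_const x y i.+1 i.+2 (c * 'C(k.-1, i) %/ i.+1)).
    - by rewrite (card_lev1E nx lexy E).
    - by move=> s Hs; rewrite -(Ns s i) ?mulnK //; lia.
    - move=> z /levP[lexz lezy Ez]; rewrite (card_lev1E nx lexz Ez) Ai //.
  have dv : (i.+1 %| c * 'C(k.-1, i))%N.
    have [||s Hs] := @lev_exists x y 1; rewrite ?E //; first lia.
    by rewrite -(Ns s i) ?dvdn_mull //; lia.
  have dc2 : (#|lev x y i.+2| * i.+2 * i.+1 = e * (c * 'C(k.-1, i)))%N.
    by rewrite -dc -mulnA divnK.
  have b1 := mul_bin_diag k.+1 i.+1; have b2 := mul_bin_diag k i.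
  rewrite /= in b1.
  transitivity (k.+1 * k * (#|lev x y i.+2| * i.+2 * i.+1))%N; first by lia.
  transitivity (e * c * (i.+1 * (i.+2 * 'C(k.+1, i.+2))))%N; last by lia.
  rewrite dc2 -b1.
  transitivity (e * c * k.+1 * (i.+1 * 'C(k, i.+1)))%N; last by lia.
  by rewrite -b2; lia.
have N1 : #|lev x y 1| = e by rewrite (card_lev1E nx lexy E).
(* Each [[s, y]] has [c] coatoms, and each coatom of [[x, y]] lies above [c] atoms, so [c] cancels
   from the double count. *)
have Nk : #|lev x y k| = e.
  case: k => [//|[//|k]] in odk gtk ltk Ai E Ak' e c c_gt0 Ns Nx N1 *.
  apply/eqP; rewrite -(eqn_pmul2r c_gt0) -[X in (X * _ == _)%N]/(#|lev x y k.+2|).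
  rewrite -(@lev_double_count_const x y k.+1 c c) ?N1 // => [s Hs|z].
    have /eqP := Ns s k (ltnSn _) Hs; rewrite /= binSn.
    by rewrite eqn_pmul2r // => /eqP.
  by move=> /levP[lexz lezy Ez]; rewrite (card_lev1E nx lexz Ez).
have N0 : #|lev x y 0| = 1%N by rewrite lev0 // cards1.
have NK : #|lev x y k.+1| = 1%N by rewrite (lev_top lexy E) cards1.
(* The scaling clears the denominators of [Nx], so that [h] vanishes for 1 < j < k. *)
pose h j := ((k.+1 * k * #|lev x y j|)%N%:R - (e * c * 'C(k.+1, j))%N%:R : int)%R.
have : (h 0%N + h k.+1 = h 1%N + h k)%R.
  apply: alternating_sum_ends => //; first lia.
  - rewrite /h (eq_bigr (fun j : 'I_k.+2 => (k.+1 * k)%N%:R * ((-1) ^+ j * #|lev x y j|%:R)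
      - (e * c)%N%:R * ((-1) ^+ j * 'C(k.+1, j)%:R))%R); last first.
      by move=> j _; rewrite !natrM; ring.
    by rewrite sumrB -!mulr_sumr (euler_lev ltxy E) alternating_sum_binomial // !mulr0 subr0.
  - by case=> [//|[//|j]] Hj; rewrite /h -(Nx j) ?[(k.+1 * k * _)%N]mulnC ?subrr //; lia.
rewrite /h N0 N1 Nk NK bin0 binn bin1 binSn => H.
have k_gt0 : (0 < k)%N by lia.
apply/eqP; rewrite -(eqn_pmul2r k_gt0); apply/eqP; lia.
Qed.

Lemma upper_atoms_id i : (0 < i <= 2 * m)%N -> A i = i.
Proof.
suff H j : (j < m)%N -> forall i, (0 < i <= 2 * j + 2)%N -> A i = i.
  by move=> Hi; apply: (H m.-1); lia.
elim: j => [_ [|[|[|i']]] //|j IH ltj {}i Hi]; rewrite ?upper_atoms1 ?upper_atoms2 //.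
pose k := (2 * j + 3)%N.
have Ai l : (0 < l < k)%N -> A l = l by move=> Hl; apply: IH; lia.
have step : (A k.+1 * k.+1 = A k.+1 * A k + k.+1)%N by apply: upper_atoms_step => //; lia.
have ck : (k.-1 <= A k)%N by rewrite -[X in (X <= _)%N]Ai ?upper_atoms_mono //; lia.
have ek : (A k <= A k.+1)%N by apply: upper_atoms_mono; lia.
(* The equation forces c <= k, and c = k-1 would give 2e = k+1, against e >= c when k >= 5. For k =
   3 the pair c = e = 2 also solves it; there [A3] decides. *)
have Ek : A k = k.
  case: (posnP j) => [j0|j_gt0]; first by rewrite /k j0 A3.
  have : (A k <= k)%N by rewrite leqNgt; apply/negP => lt; nia.
  rewrite leq_eqVlt => /orP[/eqP//|ltAk].
  have Ek1 : A k = k.-1 by lia.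
  by rewrite Ek1 in step ek; nia.
have Ek1 : A k.+1 = k.+1 by rewrite Ek in step; lia.
have [lti|] := ltnP i k; first by apply: Ai; lia.
rewrite leq_eqVlt => /orP[/eqP<-//|lti].
by have -> : i = k.+1 by lia.
Qed.

Lemma card_lev x y n j : x != \bot -> x <= y -> rk y = (rk x + n)%N ->
  #|lev x y j| = 'C(n, j).
Proof.
move=> nx lexy E; apply: card_lev_binom => // i Hi; apply: upper_atoms_id.
by have := rk_max y; rewrite -rk_gt0 in nx; lia.
Qed.

Lemma card_lev1_rk x y : x != \bot -> x <= y -> #|lev x y 1| = (rk y - rk x)%N.
Proof.
move=> nx lexy; rewrite (@card_lev x y (rk y - rk x)) ?bin1 //.
by have := rk_le lexy; lia.
Qed.

(** * Boolean upper intervals *)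

Lemma card2_other (X : {set P}) s : #|X| = 2 -> s \in X ->
  exists2 t, t != s & X = [set s; t].
Proof.
move=> + sX; rewrite (cardsD1 s) sX add1n => -[] /eqP /cards1P[t Et].
exists t; last by rewrite -(setD1K sX) Et.
by have /setD1P[] : t \in X :\ s by rewrite Et set11.
Qed.

(** Reflecting the order makes [z] determined by its atoms above [x]; the rest of Booleanness then
    follows by counting. *)
Definition embeds x := forall z1 z2, x <= z1 -> x <= z2 ->
  lev x z1 1 \subset lev x z2 1 -> z1 <= z2.

(** The elements at height [#|S|] inject into the sets of [#|S|] atoms, and both families have the
    same binomial size. *)
Lemma embeds_onto x (S : {set P}) : x != \bot -> embeds x ->
  S \subset lev x \top 1 -> exists2 z, x <= z & lev x z 1 = S.
Proof.
move=> nx emb subS; pose n := (2 * m + 1 - rk x)%N.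
have En : rk \top = (rk x + n)%N by rewrite rkT /n; have := rk_max x; lia.
pose draws := [set X : {set P} | X \subset lev x \top 1 & #|X| == #|S|].
suff /setP/(_ S) : [set lev x z 1 | z in lev x \top #|S|] = draws.
  by rewrite [S \in draws]inE subS eqxx => /imsetP[z /levP[lexz _ _] ->]; exists z.
apply/eqP; rewrite eqEcard; apply/andP; split.
  apply/subsetP => _ /imsetP[z /levP[lexz _ Ez] ->]; rewrite inE levS ?lex1 //=.
  by rewrite card_lev1_rk // Ez addKn.
rewrite cards_draws card_in_imset.
  by rewrite !(card_lev _ nx (lex1 x) En) bin1.
move=> z1 z2 /levP[le1 _ _] /levP[le2 _ _] Elev.
by apply/le_anti/andP; split; apply: emb; rewrite // Elev.
Qed.

(* If w1 <> w2 both lay above s and t, the third atom u of [x, v], where v is the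
   join of w1 and w2, would have two further elements of rank 2 above it, so that
   [x, v] would have at least four elements of rank 2 instead of three. *)
Lemma lev1_inj_upper x s t w1 w2 : x != \bot -> embeds s ->
  s \in lev x \top 1 -> w1 \in lev s \top 1 -> w2 \in lev s \top 1 ->
  t <= w1 -> t <= w2 -> t \in lev x \top 1 -> t != s -> w1 = w2.
Proof.
move=> nx emb Hs Hw1 Hw2 tw1 tw2 Ht nts; case: (eqVneq w1 w2) => // neqw; exfalso.
have [lexs _ Es] := levP _ _ _ _ Hs; have ns := le_neq_bot nx lexs.
have [lesw1 _ Ew1] := levP _ _ _ _ Hw1; have [lesw2 _ Ew2] := levP _ _ _ _ Hw2.
have [lext _ Et] := levP _ _ _ _ Ht.
have [|v lesv Ev] := @embeds_onto s [set w1; w2] ns emb.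
  by apply/subsetP => w /set2P[] ->.
have lew1v : w1 <= v by have /levP[] : w1 \in lev s v 1 by rewrite Ev set21.
have lew2v : w2 <= v by have /levP[] : w2 \in lev s v 1 by rewrite Ev set22.
have Erv : rk v = (rk x + 3)%N.
  have := card_lev1_rk ns lesv; rewrite Ev cards2 neqw; have := rk_le lesv.
  by rk_lia.
have lexv := le_trans lexs lesv.
have atw w : w \in [set w1; w2] -> lev x w 1 = [set s; t].
  move=> /set2P Hw; apply/esym/eqP; rewrite eqEcard cards2 eq_sym nts /=.
  have [lexw Ew] : s <= w /\ rk w = (rk x + 2)%N by case: Hw => ->; split=> //; rk_lia.
  rewrite card_lev_diamond ?(le_trans lexs) // andbT.
  by apply/subsetP => u /set2P[] ->; apply/levP; split=> //; case: Hw => ->.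
have [u Hu nu] : exists2 u, u \in lev x v 1 & u \notin [set s; t].
  apply/subsetPn; apply: contraTN isT => /subset_leq_card.
  by rewrite (card_lev _ nx lexv Erv) bin1 cards2; case: (s != t).
have [lexu leuv Eu] := levP _ _ _ _ Hu; have nu0 := le_neq_bot nx lexu.
have dis : [disjoint lev u v 1 & [set w1; w2]].
  apply/pred0P => w /=; apply/negP => /andP[/levP[leuw _ Ew] Hw].
  by case/negP: nu; rewrite -(atw w Hw); apply/levP.
have : lev u v 1 :|: [set w1; w2] \subset lev x v 2.
  apply/subsetP => w /setUP[/levP[leuw lewv Ew]|/set2P[]->]; apply/levP.
  - by split; [exact: le_trans leuw| |rk_lia].
  - by split; [exact: le_trans lesw1| |rk_lia].
  - by split; [exact: le_trans lesw2| |rk_lia].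
move/subset_leq_card; rewrite (card_lev _ nx lexv Erv) cardsU.
move: dis; rewrite -setI_eq0 => /eqP ->.
by rewrite cards0 cards2 neqw card_lev1_rk // Erv Eu -['C(3, 2)]/3; rk_lia.
Qed.

(** Downward induction on the rank. For an atom [s] of [[x, z1]], the induction hypothesis at [s]
    reduces the claim to the elements covering [s], and each of these is determined by its second
    atom. *)
Lemma embeds_all x : x != \bot -> embeds x.
Proof.
move En : (2 * m + 1 - rk x)%N => n; elim: n x En => [|n IH] x En nx z1 z2 le1 le2 sub.
  have xT : x = \top by apply: rk_top; have := rk_max x; rk_lia.
  by move: le2; rewrite xT le1x => /eqP ->; exact: lex1.
move: (le1); rewrite le_eqVlt => /orP[/eqP<- //|/rk_cov[s [ltxs lesz1 Es]]].
have Hs1 : s \in lev x z1 1 by apply/levP; split; rewrite // ?(ltW ltxs) ?addn1.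
have /levP[lexs lesz2 _] := subsetP sub s Hs1.
have HsT : s \in lev x \top 1 by apply/levP; rewrite lex1 addn1.
have ns := le_neq_bot nx lexs.
have embs : embeds s by apply: IH => //; rk_lia.
apply: (embs) => //; apply/subsetP => w Hw.
(* The atom of [[x, w']] besides [s]; by [otherP] the default never occurs when [w'] covers [s]. *)
pose other w' := odflt s [pick t | t \in lev x w' 1 :\ s].
have otherP w' : w' \in lev s \top 1 -> other w' \in lev x w' 1 :\ s.
  move=> /levP[lesw' _ Ew'].
  have [||t nts E] := @card2_other (lev x w' 1) s.
  - by rewrite card_lev_diamond ?(le_trans lexs) //; rk_lia.
  - by apply/levP; split=> //; rk_lia.
  rewrite /other; case: pickP => [//|/(_ t)].
  by rewrite in_setD1 nts E set22.
have other_inj : {in lev s \top 1 &, injective other}.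
  move=> w1 w2 Hw1 Hw2 Eo.
  have /setD1P[nts /levP[lext1 letw1 Et]] := otherP _ Hw1.
  have /setD1P[_ /levP[_ letw2 _]] := otherP _ Hw2.
  apply: (@lev1_inj_upper x s (other w1)) => //; first by rewrite Eo.
  by apply/levP; rewrite lex1.
(* The inclusion is an equality because both sides have [rk z2 - rk s] elements. *)
have im : other @: lev s z2 1 = lev x z2 1 :\ s.
  apply/eqP; rewrite eqEcard; apply/andP; split.
    apply/subsetP => _ /imsetP[w' Hw' ->].
    have /setD1P[nts Ho] := otherP _ (subsetP (levS _ _ (lex1 z2)) _ Hw').
    rewrite in_setD1 nts /=; apply: (subsetP (levS _ _ _)) Ho.
    by case/levP: Hw'.
  rewrite card_in_imset; last first.
    by move=> w1 w2 /(subsetP (levS _ _ (lex1 z2))) H1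
         /(subsetP (levS _ _ (lex1 z2))); apply: other_inj.
  have := cardsD1 s (lev x z2 1).
  rewrite !card_lev1_rk // (subsetP sub s Hs1); rk_lia.
have HwT := subsetP (levS s 1 (lex1 z1)) _ Hw.
have /setD1P[nts /levP[lext letw Et]] := otherP _ HwT.
have : other w \in lev x z2 1 :\ s.
  rewrite in_setD1 nts (subsetP sub) //; apply/levP; split=> //.
  by apply: le_trans letw _; case/levP: Hw.
rewrite -im => /imsetP[w' Hw' /other_inj ->] //.
exact: (subsetP (levS _ _ (lex1 z2))).
Qed.

Lemma lev1_le x z1 z2 : x != \bot -> x <= z1 -> x <= z2 ->
  (lev x z1 1 \subset lev x z2 1) = (z1 <= z2).
Proof.
move=> nx le1 le2; apply/idP/idP; first exact: embeds_all.
exact: levS.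
Qed.

Lemma lev1_onto x (S : {set P}) : x != \bot -> S \subset lev x \top 1 ->
  exists2 z, x <= z & lev x z 1 = S.
Proof. by move=> nx; apply: embeds_onto => //; apply: embeds_all. Qed.

(** * Pairs of atoms *)

(** The mate is the second atom below one fixed [w0] of rank 2; it remains to see that it does not
    depend on [w0]. *)
Lemma mate_exists a : rk a = 1%N -> exists b,
  [/\ b != a, rk b = 1%N & forall x, a <= x -> (1 < rk x)%N -> b <= x].
Proof.
move=> ra; have na : a != \bot by rewrite -rk_gt0 ra.
have [||w0 /levP[leaw0 _ Ew0]] := @lev_exists a \top 1; rewrite ?lex1 ?ra ?rkT //.
  by rk_lia.
have Hl w : a <= w -> rk w = 2%N -> #|lev \bot w 1| = 2%N.
  by move=> leaw Ew; rewrite card_lev_diamond ?le0x // rk0.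
have [||b nba Eb] := @card2_other (lev \bot w0 1) a.
- by rewrite Hl //; rk_lia.
- by apply/levP; rewrite le0x rk0 ra.
have /levP[_ lebw0 Erb] : b \in lev \bot w0 1 by rewrite Eb set22.
exists b; split=> //; first by rewrite Erb rk0.
move=> x leax gtx.
have [||w /levP[leaw lewx Ew]] := @lev_exists a x 1; rewrite ?ra //.
apply: le_trans lewx.
(* [v] is the join of [w0] and [w] above [a]. If these differ, it has rank 3, so by [A'3] its only
   atoms are the two below [w0], which are then also those below [w]. *)
have [|v leav Ev] := @lev1_onto a [set w0; w] na.
  by apply/subsetP => u /set2P[] ->; apply/levP; rewrite lex1.
have [->//|neqw] := eqVneq w w0.
have lew0v : w0 <= v by have /levP[] : w0 \in lev a v 1 by rewrite Ev set21.
have lewv : w <= v by have /levP[] : w \in lev a v 1 by rewrite Ev set22.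
have Erv : rk v = 3%N.
  have := card_lev1_rk na leav; rewrite Ev cards2 eq_sym neqw; have := rk_le leav.
  by rk_lia.
have levv u : a <= u -> u <= v -> rk u = 2%N -> lev \bot u 1 = lev \bot v 1.
  move=> leau leuv Eu; apply/eqP; rewrite eqEcard levS // (Hl u) //.
  by rewrite card_atoms Erv A'3.
have : b \in lev \bot w 1 by rewrite levv // -?(levv w0) ?Eb ?set22 //; rk_lia.
by case/levP.
Qed.

(** For an atom the default [a] is never returned, by [mateP]. *)
Definition mate a := odflt a [pick b | [&& b != a, rk b == 1%N &
  [forall x, (a <= x) && (1 < rk x)%N ==> (b <= x)]]].

Lemma mateP a : rk a = 1%N ->
  [/\ mate a != a, rk (mate a) = 1%N
    & forall x, a <= x -> (1 < rk x)%N -> mate a <= x].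
Proof.
move=> /mate_exists[b [nba Eb Hb]]; rewrite /mate; case: pickP => /= [c|/(_ b)].
  case/and3P => nca /eqP Ec /forallP Hc; split=> // x leax gtx.
  by have /implyP := Hc x; apply; rewrite leax.
rewrite nba Eb eqxx /= => /negP[]; apply/forallP => x.
by apply/implyP => /andP[]; exact: Hb.
Qed.

Lemma atoms_rk2 a w : rk a = 1%N -> a <= w -> rk w = 2%N ->
  lev \bot w 1 = [set a; mate a].
Proof.
move=> ra leaw Ew; have [nma rma Hma] := mateP ra.
apply/esym/eqP; rewrite eqEcard cards2 eq_sym nma card_lev_diamond ?le0x ?rk0 // andbT.
by apply/subsetP => u /set2P[] ->; apply/levP; rewrite le0x rk0 ?Hma ?Ew.
Qed.

(** The two atoms below an element of rank 2 above [a] are [a] and [mate a], but also [mate a] and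
    its mate. *)
Lemma mateK a : rk a = 1%N -> mate (mate a) = a.
Proof.
move=> ra; have [nma rma Hma] := mateP ra.
have [||w /levP[leaw _ Ew]] := @lev_exists a \top 1; rewrite ?lex1 ?ra ?rkT //.
  by rk_lia.
have Ew2 : rk w = 2%N by rewrite Ew ra.
have Ea := atoms_rk2 ra leaw Ew2.
have Em := atoms_rk2 rma (Hma w leaw _) Ew2.
have : mate (mate a) \in [set a; mate a] by rewrite -Ea Em ?set22 // Ew2.
have [nmma _ _] := mateP rma.
by rewrite !inE (negPf nmma) orbF => /eqP.
Qed.

(** [mate] acts on the atoms below [x] as an involution without fixed points, so a third atom brings
    a fourth. *)
Lemma card_atoms_neq3 x : (1 < rk x)%N -> #|lev \bot x 1| != 3%N.
Proof.
move=> gtx; apply/negP => /eqP E3.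
have inl u : u \in lev \bot x 1 -> u <= x /\ rk u = 1%N.
  by case/levP => _ -> ->; rewrite rk0.
have ml u : u \in lev \bot x 1 -> mate u \in lev \bot x 1.
  move=> /inl[leu ru]; have [_ rmu Hmu] := mateP ru.
  by apply/levP; rewrite le0x rk0 rmu Hmu.
have /card_gt0P[a Ha] : (0 < #|lev \bot x 1|)%N by rewrite E3.
have [_ ra] := inl a Ha; have [nma _ _] := mateP ra.
have [b Hb] : exists2 b, b \in lev \bot x 1 & b \notin [set a; mate a].
  apply/subsetPn; apply: contraTN isT => /subset_leq_card.
  by rewrite E3 cards2; case: (a != mate a).
rewrite !inE negb_or => /andP[nba nbma].
have [_ rb] := inl b Hb; have [nmb _ _] := mateP rb.
have : [set a; mate a] :|: [set b; mate b] \subset lev \bot x 1.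
  by apply/subsetP => u /setUP[]/set2P[]->; rewrite ?ml.
move/subset_leq_card; rewrite E3 cardsU !cards2 eq_sym nma eq_sym nmb.
rewrite (_ : _ :&: _ = set0) ?cards0 //.
apply/eqP; rewrite setI_eq0 disjoint_sym; apply/pred0P => u /=; rewrite !inE.
apply/negP => /andP[/orP[]/eqP-> /orP[]/eqP E].
- by rewrite E eqxx in nba.
- by rewrite E eqxx in nbma.
- by rewrite -E mateK ?eqxx in nbma.
- by move: nba; rewrite -(mateK rb) E mateK ?eqxx.
Qed.

(** * Atom numbers of the intervals with bottom 0 *)

Lemma lower_atoms_mono i j : (i <= j)%N -> (j <= 2 * m)%N -> (A' i <= A' j)%N.
Proof.
move=> leij lej.
have [||y /levP[_ _ Ey]] := @lev_exists \bot \top j; rewrite ?le0x ?rk0 ?rkT //; first rk_lia.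
have [||z /levP[_ lezy Ez]] := @lev_exists \bot y i; rewrite ?le0x ?Ey ?rk0 //.
have -> : j = rk y by rewrite Ey rk0.
have -> : i = rk z by rewrite Ez rk0.
by rewrite -!card_atoms subset_leq_card ?levS.
Qed.

(** The method of [upper_atoms_step], now for [[0, y]] with [y] of rank k+1. The intervals above
    atoms have binomial level sizes, so [A' k] enters only through the coatoms. *)
Lemma lower_atoms_step k : odd k -> (2 < k)%N -> (k < 2 * m)%N ->
  (forall i, (1 < i < k)%N -> A' i = 2%N) ->
  (A' k * 4 + A' k * A' k.+1 * k = 2 * A' k * A' k.+1 + 2 * A' k.+1 * k)%N.
Proof.
move=> odk gtk ltk Ai.
have [||y /levP[_ _ Ey]] := @lev_exists \bot \top k.+1; rewrite ?le0x ?rk0 ?rkT //; first rk_lia.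
rewrite rk0 add0n in Ey.
have E : rk y = (rk \bot + k.+1)%N by rewrite rk0.
have lt0y : \bot < y by rewrite lt0x -rk_gt0 Ey.
set e := A' k.+1; set c := A' k.
have N1 : #|lev \bot y 1| = e by rewrite card_atoms Ey.
have Ns i : {in lev \bot y 1, forall s, #|lev s y i| = 'C(k, i)}.
  move=> s /levP[_ lesy]; rewrite rk0 => Es; apply: card_lev => //.
    by rewrite -rk_gt0 Es.
  by rk_lia.
have Nx i : (0 < i)%N -> (i.+1 < k)%N -> (#|lev \bot y i.+1| * 2 = e * 'C(k, i))%N.
  move=> gti lti; rewrite -N1; apply/esym/lev_double_count_const; first exact: Ns.
  by move=> z /levP[_ _]; rewrite rk0 => Ez; rewrite card_atoms Ez Ai // lti !andbT.
have Nk : (#|lev \bot y k| * c = e * k)%N.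
  case: k => [//|k] in odk gtk ltk Ai Ey E e c N1 Ns Nx *.
  rewrite -N1 -[in RHS](binSn k); apply/esym/lev_double_count_const; first exact: Ns.
  by move=> z /levP[_ _]; rewrite rk0 => Ez; rewrite card_atoms Ez.
have N0 : #|lev \bot y 0| = 1%N by rewrite lev0 ?le0x // cards1.
have NK : #|lev \bot y k.+1| = 1%N by rewrite (lev_top (le0x y) E) cards1.
(* Each of the [e] atoms sees a row of binomial coefficients shifted by one, and an element of a
   middle level is seen by two atoms; hence such a level has half of [e * T j] elements. *)
pose T j := if j is i.+1 then 'C(k, i) else 0%N.
pose h j := ((2 * #|lev \bot y j|)%N%:R - (e * T j)%N%:R : int)%R.
have : (h 0%N + h k.+1 = h 1%N + h k)%R.
  apply: alternating_sum_ends => //; first rk_lia.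
  - rewrite /h (eq_bigr (fun j : 'I_k.+2 => 2%:R * ((-1) ^+ j * #|lev \bot y j|%:R)
        - e%:R * ((-1) ^+ j * (T j)%:R))%R); last first.
      by move=> j _; rewrite !natrM; ring.
    rewrite sumrB -!mulr_sumr (euler_lev lt0y E) big_ord_recl /= !mulr0 sub0r add0r.
    rewrite (eq_bigr (fun j : 'I_k.+1 => - ((-1) ^+ j * 'C(k, j)%:R)))%R; last first.
      by move=> j _; rewrite /bump /= exprS; ring.
    by rewrite sumrN alternating_sum_binomial ?oppr0 ?mulr0 ?oppr0 //; rk_lia.
  - by case=> [//|[//|j]] Hj; rewrite /h /T -Nx ?[(2 * _)%N]mulnC ?subrr //; case/andP: Hj.
have Tk : T k = k by case: k gtk {odk ltk Ai Ey E e c N1 Ns Nx Nk NK h} @T => //= k _; rewrite binSn.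
rewrite /h N0 N1 NK Tk /T binn bin0 => H.
have {}H : (4 + e * k = 2 * e + #|lev \bot y k| * 2)%N by move: H; clear; lia.
(* Multiplying [H] by [c] eliminates the number of coatoms through [Nk]. *)
by clearbody e c; move: Nk H; move: #|lev \bot y k| => N; clear; nia.
Qed.

Lemma lower_atoms_two i : (1 < i <= 2 * m)%N -> A' i = 2%N.
Proof.
suff H j : (j < m)%N -> forall i, (1 < i <= 2 * j + 2)%N -> A' i = 2%N.
  by case/andP => Hi1 Hi2; apply: (H m.-1); rewrite ?Hi1 /=; rk_lia.
have A'2 : A' 2 = 2%N.
  have [||y /levP[_ _ Ey]] := @lev_exists \bot \top 2; rewrite ?le0x ?rk0 ?rkT //; first rk_lia.
  by have := card_lev_diamond (le0x y) Ey; rewrite card_atoms Ey rk0.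
elim: j => [_ {}i Hi|j IH ltj {}i /andP[Hi1 Hi2]].
  by have -> : i = 2%N by move: Hi; clear; lia.
pose k := (2 * j + 3)%N.
have Ai l : (1 < l < k)%N -> A' l = 2%N.
  by case/andP => H1 H2; apply: IH; rewrite ?H1 /=; rewrite /k in H2; rk_lia.
have gtk : (2 < k)%N by rewrite /k; clear; lia.
have ltk : (k < 2 * m)%N by rewrite /k; rk_lia.
have odk : odd k by rewrite /k oddD oddM.
have step := lower_atoms_step odk gtk ltk Ai.
have ck : (2 <= A' k)%N by rewrite -A'2 lower_atoms_mono // ltnW.
have ek : (A' k <= A' k.+1)%N by apply: lower_atoms_mono.
(* The equation alone would allow c = 3, e = 12 at k = 5. *)
have c3 : A' k != 3%N.
  have [||y /levP[_ _ Ey]] := @lev_exists \bot \top k; rewrite ?le0x ?rk0 ?rkT //; first rk_lia.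
  rewrite rk0 add0n in Ey.
  by have := @card_atoms_neq3 y; rewrite card_atoms Ey; apply; apply: ltnW.
have Ek : A' k = 2%N.
  case: (posnP j) => [j0|j_gt0]; first by rewrite /k j0 A'3.
  apply/eqP; rewrite eqn_leq ck andbT leqNgt; apply/negP => gt2.
  (* For c >= 4 and k >= 5 the equation c (4 + e (k-2)) = 2 e k fails, since 4 (k-2) > 2 k. *)
  have gt3 : (3 < A' k)%N by rewrite ltn_neqAle eq_sym c3.
  have k5 : (4 < k)%N by rewrite /k; rk_lia.
  by clearbody k; move: step ek gt3 k5; move: (A' k) (A' k.+1) => c e; clear; nia.
have Ek1 : A' k.+1 = 2%N by move: step; rewrite Ek; rk_lia.
have [lti|] := ltnP i k; first by apply: Ai; rewrite Hi1.
rewrite leq_eqVlt => /orP[/eqP<-//|lti].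
by have -> : i = k.+1 by rewrite /k in lti *; rk_lia.
Qed.

Lemma atoms_below a x : rk a = 1%N -> a <= x -> (1 < rk x <= 2 * m)%N ->
  lev \bot x 1 = [set a; mate a].
Proof.
move=> ra leax Hx; have [nma rma Hma] := mateP ra; case/andP: (Hx) => gtx _.
apply/esym/eqP; rewrite eqEcard cards2 eq_sym nma card_atoms lower_atoms_two // andbT.
by apply/subsetP => u /set2P[] ->; apply/levP; rewrite le0x rk0 ?Hma.
Qed.

(** * The isomorphism *)

(** A numbering of the elements covering [a]; for an atom, [size_coord] shows that indices below
    [2 * m] never reach the default. *)
Definition coord a i : P := nth \bot (enum (lev a \top 1)) i.

Definition coords a z : {set 'I_(2 * m)} := [set i : 'I_(2 * m) | coord a i <= z].

Lemma atom_neq_bot a : rk a = 1%N -> a != \bot.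
Proof. by rewrite -rk_gt0 => ->. Qed.

Lemma size_coord a : rk a = 1%N -> size (enum (lev a \top 1)) = (2 * m)%N.
Proof.
by move=> ra; rewrite -cardE card_lev1_rk ?lex1 ?atom_neq_bot // rkT ra addnK.
Qed.

Lemma mem_coord a (i : 'I_(2 * m)) : rk a = 1%N -> coord a i \in lev a \top 1.
Proof. by move=> ra; rewrite -mem_enum mem_nth // size_coord. Qed.

Lemma coord_le a z (i : 'I_(2 * m)) : rk a = 1%N ->
  (coord a i <= z) = (coord a i \in lev a z 1).
Proof.
move=> ra; have /levP[le1 _ E] := mem_coord i ra.
by apply/idP/idP => [lez|/levP[]//]; apply/levP.
Qed.

Lemma coord_onto a t : rk a = 1%N -> t \in lev a \top 1 ->
  exists i : 'I_(2 * m), coord a i = t.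
Proof.
move=> ra Ht; have lti : (index t (enum (lev a \top 1)) < 2 * m)%N.
  by rewrite -(size_coord ra) index_mem mem_enum.
by exists (Ordinal lti); rewrite /coord nth_index ?mem_enum.
Qed.

Lemma coord_inj a (i j : 'I_(2 * m)) : rk a = 1%N -> coord a i = coord a j -> i = j.
Proof.
move=> ra /eqP; rewrite nth_uniq ?size_coord ?enum_uniq // => /eqP; exact: val_inj.
Qed.

Lemma coords_le a z1 z2 : rk a = 1%N -> a <= z1 -> a <= z2 ->
  (coords a z1 \subset coords a z2) = (z1 <= z2).
Proof.
move=> ra le1 le2; apply/idP/idP => [/subsetP sub|le12]; last first.
  by apply/subsetP => i; rewrite !inE => /le_trans; apply.
rewrite -(lev1_le (atom_neq_bot ra) le1 le2); apply/subsetP => t Ht.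
have [i Ei] := coord_onto ra (subsetP (levS a 1 (lex1 z1)) _ Ht).
have Hi : i \in coords a z1 by rewrite inE coord_le ?Ei.
by have := sub i Hi; rewrite inE coord_le ?Ei.
Qed.

Lemma coords_inj a z1 z2 : rk a = 1%N -> a <= z1 -> a <= z2 ->
  coords a z1 = coords a z2 -> z1 = z2.
Proof.
move=> ra le1 le2 E; apply/le_anti/andP; split.
  by rewrite -(coords_le ra) // E.
by rewrite -(coords_le ra) // E.
Qed.

Lemma coords_onto a (S : {set 'I_(2 * m)}) : rk a = 1%N ->
  exists2 z, a <= z & coords a z = S.
Proof.
move=> ra; have [|z leaz Ez] := @lev1_onto a [set coord a (i : 'I_(2 * m)) | i in S] (atom_neq_bot ra).
  by apply/subsetP => _ /imsetP[i _ ->]; exact: mem_coord.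
exists z => //; apply/setP => i; rewrite inE coord_le // Ez.
by apply/imsetP/idP => [[j Hj /(coord_inj ra) ->] //|Hi]; exists i.
Qed.

Lemma coords_top a : coords a \top = setT.
Proof. by apply/setP => i; rewrite !inE lex1. Qed.

Lemma coords_atom a : rk a = 1%N -> coords a a = set0.
Proof.
move=> ra; apply/setP => i; rewrite !inE; apply/negP => /rk_le.
by have /levP[_ _ ->] := mem_coord i ra; rewrite ra.
Qed.

(** For an atom [a], the inverse of [coords a] on [[a, 1]]; the default is then never taken. *)
Definition of_coords a (S : {set 'I_(2 * m)}) : P :=
  odflt \bot [pick z | (a <= z) && (coords a z == S)].

Lemma of_coordsP a S : rk a = 1%N ->
  a <= of_coords a S /\ coords a (of_coords a S) = S.
Proof.
move=> ra; rewrite /of_coords; case: pickP => [z /andP[? /eqP]//|].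
by have [z leaz Ez] := coords_onto S ra; move/(_ z); rewrite leaz Ez eqxx.
Qed.

(* Exactly one atom of each pair of mates. *)
Definition reps : {set P} :=
  [set a | (rk a == 1%N) && (enum_rank a < enum_rank (mate a))%N].

Definition rep (i : 'I_#|reps|) : P := enum_val i.

Definition atom (i : 'I_#|reps|) (b : bool) : P :=
  if b then mate (rep i) else rep i.

Lemma rk_rep i : rk (rep i) = 1%N.
Proof. by have := enum_valP i; rewrite inE => /andP[/eqP]. Qed.

Lemma rep_lt i : (enum_rank (rep i) < enum_rank (mate (rep i)))%N.
Proof. by have := enum_valP i; rewrite inE => /andP[]. Qed.

Lemma rk_atom i b : rk (atom i b) = 1%N.
Proof. by case: b; rewrite /atom ?rk_rep //; case: (mateP (rk_rep i)). Qed.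

(** A representative is never the mate of a representative: by [mateK] the two strict inequalities
    from [reps] would contradict each other. *)
Lemma atom_inj i j b b' : atom i b = atom j b' -> i = j /\ b = b'.
Proof.
have lti := rep_lt i; have ltj := rep_lt j.
have Ki := mateK (rk_rep i); have Kj := mateK (rk_rep j).
rewrite /atom; case: b; case: b' => E.
- by split=> //; apply: enum_val_inj; rewrite -[LHS]Ki E Kj.
- by move: lti ltj; rewrite -E Ki => /ltn_trans H /H; rewrite ltnn.
- by move: lti ltj; rewrite E Kj => /ltn_trans H /H; rewrite ltnn.
- by split=> //; apply: enum_val_inj.
Qed.

Lemma atom_onto a : rk a = 1%N -> exists i b, atom i b = a.
Proof.
move=> ra; have [nma rma _] := mateP ra.
have [lt|] := ltnP (enum_rank a) (enum_rank (mate a)).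
  have Ha : a \in reps by rewrite inE ra lt.
  by exists (enum_rank_in Ha a), false; rewrite /atom /rep enum_rankK_in.
rewrite leq_eqVlt => /orP[/eqP/val_inj/enum_rank_inj E|lt].
  by rewrite E eqxx in nma.
have Ha : mate a \in reps by rewrite inE rma mateK ?lt.
by exists (enum_rank_in Ha (mate a)), true; rewrite /atom /rep enum_rankK_in ?mateK.
Qed.

Lemma atom_le i b x : (1 < rk x)%N -> (atom i b <= x) = (rep i <= x).
Proof.
move=> gtx; case: b => //; have [_ rm Hm] := mateP (rk_rep i).
apply/idP/idP => [le|/Hm]; last exact.
by rewrite -(mateK (rk_rep i)); have [_ _] := mateP rm; apply.
Qed.

(** Only one pair of mates lies below an element of such a rank. This separates the copies outside
    their common bounds. *)
Lemma rep_le_inj i j x : (1 < rk x <= 2 * m)%N -> rep i <= x -> rep j <= x -> i = j.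
Proof.
move=> Hx lei lej; have E := atoms_below (rk_rep i) lei Hx.
have : rep j \in lev \bot x 1 by apply/levP; rewrite le0x rk0 rk_rep.
by rewrite E => /set2P[/(@atom_inj j i false false)|/(@atom_inj j i false true)] [].
Qed.

Local Notation Q := (dual_susp (boolean_lattice (2 * m))).

(** The empty set needs its own case: it is the bottom of its copy and must go to 0, whereas
    [of_coords] would send it to the representative atom. *)
Definition from_boxplus (u : boxplus #|reps| Q) : P :=
  match (val u).2 with
  | inl X => if X == set0 then \bot else of_coords (rep (val u).1) X
  | inr b => atom (val u).1 b
  end.

Lemma rk_of_coords i (S : {set 'I_(2 * m)}) : S != set0 -> S != setT ->
  (1 < rk (of_coords (rep i) S) <= 2 * m)%N.
Proof.
move=> S0 ST; have ra := rk_rep i; have [le E] := of_coordsP S ra; apply/andP; split.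
  rewrite -ra; apply: rk_lt; rewrite lt_neqAle le andbT.
  by apply: contraNneq S0 => H; rewrite -E -H coords_atom.
rewrite -ltnS -[X in (_ < X)%N]addn1 ltn_neqAle rk_max andbT.
by apply: contraNneq ST => /rk_top H; rewrite -E H coords_top.
Qed.

Lemma of_coordsT i : of_coords (rep i) setT = \top.
Proof.
have ra := rk_rep i; have [le E] := of_coordsP setT ra.
by apply: (coords_inj ra); rewrite ?lex1 // E coords_top.
Qed.

Lemma from_boxplus_mono : {mono from_boxplus : u v / u <= v}.
Proof.
have m2_gt0 : (0 < 2 * m)%N by rk_lia.
move=> [[i p] up] [[j q] vp]; rewrite /from_boxplus [RHS]/Order.le /= /boxplus_le /=.
case: p q {up vp} => [S|b] [S'|b'].
- rewrite dual_susp_inlE is_min_inl is_max_inl //.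
  have [->|S0] := eqVneq S set0; first by rewrite le0x sub0set orbT.
  have [->|S'0] := eqVneq S' set0.
    rewrite lex0 subset0 (negPf S0) /=; apply/negbTE.
    have [le _] := of_coordsP S (rk_rep i).
    exact: le_neq_bot (atom_neq_bot (rk_rep i)) le.
  have [->|S'T] := eqVneq S' setT; first by rewrite of_coordsT lex1 subsetT !orbT.
  rewrite !orbF; have [lei Ei] := of_coordsP S (rk_rep i).
  have [lej Ej] := of_coordsP S' (rk_rep j).
  have Hx := rk_of_coords j S'0 S'T.
  (* The upper element has rank between 2 and [2 * m], so the pair of atoms below it determines its
     copy. *)
  apply/idP/andP => [le|[sub /eqP eij]].
    have eij := rep_le_inj Hx (le_trans lei le) lej; split; last exact/eqP.
    subst j; rewrite -Ei -Ej coords_le ?rk_rep //.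
  by subst j; rewrite -(coords_le (rk_rep i)) // Ei Ej.
- rewrite dual_susp_inl_inr is_min_inl is_max_inr.
  have [_|S0] := eqVneq S set0; first by rewrite le0x orbT.
  have [lei Ei] := of_coordsP S (rk_rep i).
  (* An element of [[rep i, 1]] below an atom must be [rep i] itself, whose coordinate set is
     empty. *)
  apply/negP => /= le; case/negP: S0; apply/eqP.
  rewrite -Ei (_ : of_coords _ _ = rep i) ?coords_atom ?rk_rep //.
  apply/esym/rk_eq => //; apply/eqP; rewrite eqn_leq rk_le //=.
  by rewrite rk_rep -(rk_atom j b') rk_le.
- rewrite dual_susp_inr_inl is_min_inr is_max_inl //.
  have [->|S'0] := eqVneq S' set0.
    by rewrite lex0; apply/negbTE/atom_neq_bot/rk_atom.
  have [->|S'T] := eqVneq S' setT; first by rewrite of_coordsT lex1 !orbT.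
  have Hx := rk_of_coords j S'0 S'T; have [lej Ej] := of_coordsP S' (rk_rep j).
  rewrite /= !orbF atom_le; last by case/andP: Hx.
  by apply/idP/eqP => [lei|->//]; exact: rep_le_inj lej.
- rewrite dual_susp_inrE is_min_inr is_max_inr !orbF.
  apply/idP/andP => [le|[/eqP-> /eqP->] //].
  by have [-> ->] := atom_inj (rk_eq le (etrans (rk_atom _ _) (esym (rk_atom _ _)))).
Qed.

Lemma reps_gt0 : (0 < #|reps|)%N.
Proof.
have [||a /levP[_ _ Ea]] := @lev_exists \bot \top 1; rewrite ?le0x ?rk0 ?rkT //; first rk_lia.
rewrite rk0 in Ea; have [i _] := atom_onto Ea.
exact: leq_ltn_trans (ltn_ord i).
Qed.

Lemma from_boxplus_onto x : exists u, from_boxplus u = x.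
Proof.
have m2_gt0 : (0 < 2 * m)%N by rk_lia.
(* Both common bounds are represented in copy 0, as [boxplus_pred] demands. *)
have [->|nx0] := eqVneq x \bot.
  have up : boxplus_pred (Ordinal reps_gt0, inl set0 : Q) by rewrite /boxplus_pred eqxx implybT.
  by exists (BoxPlus up); rewrite /from_boxplus /= eqxx.
have [->|nxT] := eqVneq x \top.
  have up : boxplus_pred (Ordinal reps_gt0, inl setT : Q) by rewrite /boxplus_pred eqxx implybT.
  exists (BoxPlus up); rewrite /from_boxplus /= of_coordsT ifF //.
  by apply/negbTE; rewrite -card_gt0 cardsT card_ord.
have [rx1|rx1] := eqVneq (rk x) 1%N.
  have [i [b Ex]] := atom_onto rx1.
  have up : boxplus_pred (i, inr b : Q) by rewrite /boxplus_pred /= is_min_inr is_max_inr.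
  by exists (BoxPlus up).
have gtx : (1 < rk x)%N by rewrite ltn_neqAle eq_sym rx1 rk_gt0.
have [||a /levP[_ leax Ea]] := @lev_exists \bot x 1; rewrite ?le0x ?rk0 //; first rk_lia.
rewrite rk0 in Ea; have [i [b Ei]] := atom_onto Ea.
have leix : rep i <= x by rewrite -(atom_le i b) ?Ei.
have ra := rk_rep i.
pose S := coords (rep i) x.
have S0 : S != set0.
  apply: contra_neq rx1 => E; rewrite -(coords_inj ra (lexx _) leix) //.
  by rewrite coords_atom.
have ST : S != setT.
  by apply: contra_neq nxT => E; apply: (coords_inj ra); rewrite ?lex1 // coords_top.
have up : boxplus_pred (i, inl S : Q).
  by rewrite /boxplus_pred /= is_min_inl is_max_inl // (negPf S0) (negPf ST).
exists (BoxPlus up); rewrite /from_boxplus /= (negPf S0).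
have [lei Ei'] := of_coordsP S ra; exact: (coords_inj ra).
Qed.

(** By antisymmetry [from_boxplus] is injective, so a section of this surjection is a two-sided
    inverse. *)
Lemma order_iso_boxplus : order_iso P (boxplus #|reps| Q).
Proof.
have onto x : exists u, from_boxplus u == x.
  by have [u <-] := from_boxplus_onto x; exists u.
pose f x := xchoose (onto x).
have fK x : from_boxplus (f x) = x by apply/eqP; apply: (xchooseP (onto x)).
have Kf u : f (from_boxplus u) = u.
  by apply/le_anti; rewrite -!from_boxplus_mono !fK lexx.
exists f; first by exists from_boxplus.
by move=> x y; rewrite -from_boxplus_mono !fK.
Qed.

End RankedPoset.

(** * The rank function of a Sheffer poset *)

Section ShefferRank.
Local Open Scope order_scope.
Variables (d : Order.disp_t) (P : finTBPOrderType d) (D B : nat -> nat).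
Implicit Types (x y z s t : P).
Hypothesis shP : sheffer P D B.

Let graded x y : x <= y -> graded_intv x y.
Proof. by case: shP => H _ _; apply: H. Qed.

Let rk := @rank d P.

(** Induction on the length of [[x, 1]], moving from [x] to an element that covers it and lies below
    [y]. *)
Lemma intv_length_add x y : x <= y ->
  intv_length x \top = (intv_length x y + intv_length y \top)%N.
Proof.
move E : (intv_length x \top) => n; elim: n x E => [|n IH] x E lexy.
all: move: (lexy); rewrite le_eqVlt => /orP[/eqP <-|/covered_exists[s cov lesy]].
1,3: by rewrite intv_length_refl E.
all: have ltxs : x < s by case/andP: cov.
all: have := E; rewrite (intv_length_covered _ _ cov) ?lex1 //; try exact: graded (lex1 _).
case=> Es; rewrite (intv_length_covered _ _ cov) //; try exact: graded.
by rewrite addSn -(IH s).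
Qed.

Lemma rank_intv_length x y : x <= y -> rk y = (rk x + intv_length x y)%N.
Proof.
move=> lexy; have := intv_length_add (le0x x).
by rewrite (intv_length_add (le0x y)) (intv_length_add lexy) addnA => /addIn.
Qed.

Lemma rank0 : rk \bot = 0%N.
Proof. exact: intv_length_refl. Qed.

Lemma rank_covered x s : covered x s -> rk s = (rk x).+1.
Proof.
move=> cov; have ltxs : x < s by case/andP: cov.
rewrite (rank_intv_length (ltW ltxs)).
rewrite (intv_length_covered _ _ cov) ?intv_length_refl ?addn1 //.
  exact: graded (ltW ltxs).
exact: graded.
Qed.

Lemma rank_cov x y : x < y -> exists s, [/\ x < s, s <= y & rk s = (rk x).+1].
Proof.
case/covered_exists=> s cov lesy; exists s; split=> //; last exact: rank_covered.
by case/andP: cov.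
Qed.

Lemma rank_lt x y : x < y -> (rk x < rk y)%N.
Proof.
case/covered_exists=> s /rank_covered Es lesy.
by rewrite (rank_intv_length lesy) Es addSn ltnS leq_addr.
Qed.

Lemma lev1_covered x y s : (s \in lev rk x y 1) = covered x s && (s <= y).
Proof.
apply/levP/andP => [[lexs lesy]|[cov lesy]]; last first.
  split=> //; first by case/andP: cov => /ltW.
  by rewrite addn1; exact: rank_covered.
rewrite addn1 => Es.
split=> //; rewrite /covered lt_neqAle lexs andbT; apply/andP; split.
  by apply: contra_eqN Es => /eqP->; rewrite neq_ltn ltnSn.
apply/forallP => z; apply/implyP => /rank_lt ltxz; apply/negP => /rank_lt.
by rewrite Es ltnS leqNgt ltxz.
Qed.

Lemma card_maxchains_lev x y : x < y ->
  #|maxchains x y| = (\sum_(s in lev rk x y 1) #|maxchains s y|)%N.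
Proof.
move=> ltxy; rewrite card_maxchains //; apply: eq_bigl => s.
by rewrite lev1_covered.
Qed.

(** The atoms of [[x, y]] differ from 0 even if [x] is 0, so [B] counts the chains above them in
    both cases. Positivity of [B n] is what later permits division. *)
Lemma card_maxchains_above x y n : x < y -> rk y = (rk x + n.+1)%N ->
  #|maxchains x y| = (#|lev rk x y 1| * B n)%N /\ (0 < B n)%N.
Proof.
case: shP => _ _ HB ltxy E.
have HBs s : s \in lev rk x y 1 -> #|maxchains s y| = B n.
  case/levP => lexs lesy; rewrite addn1 => Es; rewrite HB //.
    have := rank_intv_length lesy; rewrite E Es addSnnS.
    by move/addnI => -[<-].
  by apply: contra_eqN Es => /eqP->; rewrite rank0.
split; first by rewrite card_maxchains_lev // (eq_bigr _ HBs) sum_nat_const.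
have [s] := covered_exists ltxy => cov lesy.
by rewrite -(HBs s) ?maxchains_gt0 // lev1_covered cov.
Qed.

Lemma card_lev1_sheffer x y n : x < y -> rk y = (rk x + n.+1)%N ->
  #|lev rk x y 1| = ((if x == \bot then D n.+1 else B n.+1) %/ B n)%N.
Proof.
move=> ltxy E; have [Ec Bn] := card_maxchains_above ltxy E.
have En : intv_length x y = n.+1.
  by have := rank_intv_length (ltW ltxy); rewrite E => /addnI.
case: shP => _ HD HB; move: Ec; have [x0|nx] := eqVneq x \bot.
  by rewrite x0 in En *; rewrite HD En => ->; rewrite mulnK.
by rewrite HB ?(ltW ltxy) // En => ->; rewrite mulnK.
Qed.

End ShefferRank.

Theorem theorem4p14 (d : Order.disp_t) (P : finTBPOrderType d)
    (D B : nat -> nat) (m : nat) :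
  eulerian P -> sheffer P D B ->
  poset_rank P = 2 * m + 1 -> 5 <= 2 * m + 1 ->
  B 3 = 6 -> D 3 = 4 ->
  exists2 alpha : nat, 0 < alpha &
    order_iso P (boxplus alpha (dual_susp (boolean_lattice (2 * m)))).
Proof.
move=> euP shP rkT m_ge B3 D3; pose rk := @rank d P.
have rk0 : rk \bot%O = 0 := rank0 P.
have rkl := rank_lt shP; have rkc := rank_cov shP; have [_ eu] := euP.
have m_gt1 : 1 < m by move: m_ge; clear; lia.
(* [F B] and [F D] are the atom numbers belonging to the two factorial functions; the value 0 at 0
   fits the one-element intervals. *)
pose F (C : nat -> nat) n := if n is k.+1 then C k.+1 %/ B k else 0.
have lt_len x y : (x < y)%O -> exists n, rk y = rk x + n.+1.
  by move/rkl => lt; exists (rk y - rk x).-1; move: lt; rewrite -/rk; clear; lia.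
have lev_refl x : #|lev rk x x 1| = 0.
  apply/eqP; rewrite cards_eq0 -subset0; apply/subsetP => z /levP[le1 le2].
  rewrite (_ : z = x) ?addn1; first by move/n_Sn.
  by apply/le_anti; rewrite le2.
have cA x y : x != \bot%O -> (x <= y)%O -> #|lev rk x y 1| = F B (rk y - rk x).
  move=> nx; rewrite le_eqVlt => /orP[/eqP<-|ltxy]; first by rewrite lev_refl subnn.
  have [n E] := lt_len _ _ ltxy.
  by rewrite (card_lev1_sheffer shP ltxy E) (negPf nx) E addKn.
have cA' y : #|lev rk \bot%O y 1| = F D (rk y).
  have [->|ny] := eqVneq y \bot%O; first by rewrite lev_refl rk0.
  have lt0y : (\bot < y)%O by rewrite lt0x.
  have [n E] := lt_len _ _ lt0y.
  by rewrite (card_lev1_sheffer shP lt0y E) eqxx E rk0.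
(* Needed to turn the hypotheses at 3 into atom numbers, B(3)/B(2) = 3 and D(3)/B(2) = 2. An
   interval of length 2 above an element of rank 1 has two atoms, hence two maximal chains. *)
have B2 : B 2 = 2.
  have [||x /levP[_ _ Ex]] := @lev_exists _ _ rk rkc \bot%O \top%O 1.
  - exact: le0x.
  - by rewrite rk0 [rk _]rkT; move: m_ge; clear; lia.
  rewrite rk0 in Ex.
  have nx : x != \bot%O by apply: contra_eqN Ex => /eqP->; rewrite rk0.
  have [||y /levP[lexy _ Ey]] := @lev_exists _ _ rk rkc x \top%O 2.
  - exact: lex1.
  - by rewrite Ex [rk _]rkT; move: m_ge; clear; lia.
  have ltxy : (x < y)%O.
    by rewrite lt_neqAle lexy andbT; apply: contra_eqN Ey => /eqP->; clear; lia.
  have [E1 _] := card_maxchains_above shP ltxy Ey.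
  have [s [ltxs lesy]] := rkc _ _ ltxy; rewrite -addn1 => Es.
  have [E2 _] := card_maxchains_above shP ltxs Es.
  have [_ _ HB] := shP.
  have len u v n : (u <= v)%O -> rk v = rk u + n -> intv_length u v = n.
    by move=> /(rank_intv_length shP) E3; rewrite /rk E3; exact: addnI.
  have B0 : B 0 = 1.
    by rewrite -[LHS](f_equal B (intv_length_refl x)) -HB // maxchains_refl cards1.
  have B1 : B 1 = 1.
    rewrite -[LHS](f_equal B (len x s 1 (ltW ltxs) Es)) -HB ?(ltW ltxs) // E2 B0 muln1.
    by rewrite (lev_top rkl (ltW ltxs) Es) cards1.
  rewrite -[LHS](f_equal B (len x y 2 lexy Ey)) -HB // E1 B1 muln1.
  exact: (card_lev_diamond rkl eu).
have A3 : F B 3 = 3 by rewrite /F B3 B2.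
have A'3 : F D 3 = 2 by rewrite /F D3 B2.
exists #|reps rk|.
  exact: (reps_gt0 rkl rkc eu rk0 rkT m_gt1 cA cA' A3 A'3).
exact: (order_iso_boxplus rkl rkc eu rk0 rkT m_gt1 cA cA' A3 A'3).
Qed.
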